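(* If $T$ is a tournament, then $\gamma(T)\leq \gamma_{\mathrm{t}}(T)\leq w(T)$.
   Context: A tournament is an orientation of a finite complete graph. A set $S$ of vertices of a digraph is dominating if every vertex is in $S$ or is an out-neighbour of a vertex in $S$; $\gamma(T)$ is the minimum size of a dominating set in $T$. The total domination number $\gamma_{\mathrm{t}}(D)$ of a digraph $D$ is the size of the smallest set $S$ such that for every vertex $v$ in $D$ there is a vertex $u\neq v$ in $S$ such that $(u,v)$ is an arc. A walk follows the direction of arcs and may repeat vertices and arcs; its length is the number of arcs traversed (counted with repetition); a single vertex is a closed walk of length $0$. A closed dominating walk is a closed walk whose vertex set is dominating. A watchman's walk is a closed dominating walk of minimum length, and $w(T)$ (the watchman number) is the length of a watchman's walk in $T$. Every tournament has a watchman's walk, so $w(T)$ is well defined.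
   Formalization: The formal theorem assumes that T has a total dominating set (equivalently, no source), so that γ_t(T) is defined; if T has a source, γ_t(T) is undefined, and γ(T)=1 while w(T)=0, so the chain fails. *)

(* Defs.v *)
From mathcomp Require Import all_boot.

Set Implicit Arguments.
Unset Strict Implicit.
Unset Printing Implicit Defensive.

(* A digraph is a relation e on a finType V; e u v means that (u, v) is an
   arc. Graphs are nonempty by convention: the tournament without vertices has
   no walk at all, hence no watchman's walk. *)
Record tournament (V : finType) (e : rel V) : Prop := Tournament {
  tournament_nonempty : 0 < #|V|;
  tournament_irr : irreflexive e;
  tournament_xor : forall u v : V, u != v -> e u v (+) e v u
}.

Section Domination.
Variables (V : finType) (e : rel V).
Implicit Types S : {set V}.

Definition dominating S : bool :=
  [forall v, (v \in S) || [exists u in S, e u v]].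

Definition total_dominating S : bool :=
  [forall v, [exists u in S, (u != v) && e u v]].

(* setT is always dominating, so this is a genuine minimum. *)
Definition domination_number : nat :=
  #|[arg min_(S < setT | dominating S) #|S| ]|.

(* Total domination is inherited by supersets, so setT is a legitimate
   starting point as soon as some total dominating set exists. Otherwise (some
   vertex has no in-neighbour) the number is undefined, and the value #|V|
   given here is meaningless. *)
Definition total_domination_number : nat :=
  #|[arg min_(S < setT | total_dominating S) #|S| ]|.

(* The walk x, p_1, ..., p_k has vertex sequence x :: p and length size p. *)
Definition closed_walk (x : V) (p : seq V) : bool :=
  path e x p && (last x p == x).

Definition closed_dominating_walk (x : V) (p : seq V) : bool :=
  closed_walk x p && dominating [set v in x :: p].

Definition has_closed_dominating_walk (n : nat) : bool :=
  [exists x : V, [exists p : n.-tuple V, closed_dominating_walk x p]].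

Lemma closed_walk_through (x : V) (s : seq V) :
  (forall v, v \in s -> connect e x v && connect e v x) ->
  exists2 p, closed_walk x p & {subset s <= x :: p}.
Proof.
elim: s => [|v s IHs] sP; first by exists [::]; rewrite /closed_walk /=.
have [u us|p /andP[ep /eqP lp] sub] := IHs; first by rewrite sP // inE us orbT.
have /andP[/connectP[q eq lq] /connectP[r er lr]] := sP v (mem_head v s).
exists (q ++ r ++ p).
  by rewrite /closed_walk !cat_path !last_cat -lq -lr eq er ep lp eqxx.
move=> u; rewrite inE -!cat_cons !mem_cat => /predU1P[->|/sub].
  by rewrite {1}lq mem_last.
by rewrite !inE => /orP[->|->] //; rewrite !orbT.
Qed.

Lemma tournament_closed_dominating_walk :
  tournament e -> exists n, has_closed_dominating_walk n.
Proof.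
case=> /card_gt0P[x0 _] _ xorP.
case: (@arg_maxnP V x0 predT (fun x => #|connect e x|)) => // x _ maxx.
have xall v : connect e x v.
  apply/negPn/negP => Nxv.
  have neq : x != v by apply: contraNneq Nxv => <-.
  have evx : e v x.
    by move: (xorP _ _ neq); case: (boolP (e x v)) => // /connect1; rewrite (negPf Nxv).
  suff /proper_card : connect e x \proper connect e v.
    by move=> lt; have := maxx v isT; rewrite /= leqNgt lt.
  apply/properP; split; last by exists v; [exact: connect0 | exact: Nxv].
  by apply/subsetP => u; apply: connect_trans; apply: connect1.
have [v|p cw sub] := @closed_walk_through x (enum [pred v | connect e v x]).
  by rewrite mem_enum inE xall.
exists (size p); apply/existsP; exists x; apply/existsP; exists (in_tuple p).
rewrite /closed_dominating_walk cw /=; apply/forallP => v; rewrite inE.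
have [cvx|Ncvx] := boolP (connect e v x); first by rewrite sub // mem_enum.
apply/orP; right; apply/existsP; exists x; rewrite !inE eqxx /=.
have /xorP : x != v by apply: contraNneq Ncvx => ->.
by case: (boolP (e v x)) => [/connect1|_]; rewrite ?(negPf Ncvx) // addbF.
Qed.

Definition watchman_number (te : tournament e) : nat :=
  ex_minn (tournament_closed_dominating_walk te).

End Domination.

(* Main.v *)
Require Import Defs.
From mathcomp Require Import all_boot.

(** In a closed dominating walk of positive length, every vertex of the walk is
an out-neighbour of its predecessor, so the vertex set of the walk is total
dominating. A dominating walk of length 0 sits at a vertex without
in-neighbour, and then there is no total dominating set at all. *)

Lemma total_dominatingW (V : finType) (e : rel V) (S : {set V}) :
  total_dominating e S -> dominating e S.
Proof.
move/forallP => tS; apply/forallP => v; apply/orP; right.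
by have /existsP[u /and3P[uS _ euv]] := tS v; apply/existsP; exists u; rewrite uS.
Qed.

Lemma total_dominating_sub (V : finType) (e : rel V) (S S' : {set V}) :
  S \subset S' -> total_dominating e S -> total_dominating e S'.
Proof.
move=> /subsetP sub /forallP tS; apply/forallP => v.
have /existsP[u /andP[uS uv]] := tS v.
by apply/existsP; exists u; rewrite sub.
Qed.

Lemma domination_number_le (V : finType) (e : rel V) (S : {set V}) :
  dominating e S -> domination_number e <= #|S|.
Proof.
rewrite /domination_number; case: arg_minnP => [|S0 _]; last exact.
by apply/forallP => v; rewrite inE.
Qed.

Lemma total_domination_numberP (V : finType) (e : rel V) :
  (exists S : {set V}, total_dominating e S) ->
  exists2 S : {set V},
    total_dominating e S & #|S| = total_domination_number e.
Proof.
case=> S tS; rewrite /total_domination_number.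
case: arg_minnP => [|S0 tS0 _]; last by exists S0.
exact: total_dominating_sub (subsetT S) tS.
Qed.

Lemma total_domination_number_le (V : finType) (e : rel V) (S : {set V}) :
  total_dominating e S -> total_domination_number e <= #|S|.
Proof.
move=> tS; rewrite /total_domination_number.
case: arg_minnP => [|S0 _]; last exact.
exact: total_dominating_sub (subsetT S) tS.
Qed.

(** Cut [p] at an occurrence of [v]: the predecessor is the last vertex of the part before it, or
    [x] itself when that part is empty. *)
Lemma path_pred (T : eqType) (e : rel T) (x : T) (p : seq T) (v : T) :
  path e x p -> v \in p -> exists2 u, u \in x :: p & e u v.
Proof.
move=> ep vp; case/splitPr: vp ep => p1 p2.
rewrite cat_path => /andP[_ /andP[elv _]].
by exists (last x p1); rewrite // -cat_cons mem_cat mem_last.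
Qed.

(** Taking the set from [p] and not from [x :: p] bounds its size by the length of the walk, without
    an extra one. No vertex is lost: a closed walk of positive length ends at [x], so [x] occurs in
    [p]. *)
Lemma closed_walk_total_dominating (V : finType) (e : rel V) (x : V)
    (p : seq V) :
  irreflexive e -> p != [::] -> closed_dominating_walk e x p ->
  total_dominating e [set v in p].
Proof.
move=> irr pN0 /andP[/andP[ep /eqP lp] /forallP dom].
have xp : x \in p by case: p pN0 lp {ep dom} => //= y q _ <-; exact: mem_last.
have memE : x :: p =i p by move=> v; rewrite inE; case: eqP => // ->.
have neq u v : e u v -> u != v by apply: contraTneq => ->; rewrite irr.
apply/forallP => v; apply/existsP.
(* On the walk, [v] has its predecessor as in-neighbour; off the walk, domination provides one. *)
have := dom v; rewrite inE memE => /orP[/(path_pred _ _ _ _ _ ep)[u]|/existsP[u]].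
  by rewrite memE => up euv; exists u; rewrite inE up euv neq.
by rewrite inE memE => /andP[up euv]; exists u; rewrite inE up euv neq.
Qed.

(** An in-neighbour [u] of [x] in [S] differs from [x], so it is itself dominated by [x]; arcs in
    both directions are impossible in a tournament. *)
Lemma tournament_dominating1 (V : finType) (e : rel V) (x : V)
    (S : {set V}) :
  tournament e -> dominating e [set x] -> ~~ total_dominating e S.
Proof.
move=> te /forallP dom; apply/negP => /forallP/(_ x)/existsP[u /and3P[_ ux eux]].
have := dom u; rewrite inE (negPf ux) => /existsP[y].
rewrite inE => /andP[/eqP-> exu].
by have := tournament_xor te ux; rewrite eux exu.
Qed.

Theorem theorem4p9 (V : finType) (e : rel V) (te : tournament e)
  (total_defined : exists S : {set V}, total_dominating e S) :
  domination_number e <= total_domination_number e /\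
  total_domination_number e <= watchman_number te.
Proof.
split.
  have [S tS <-] := total_domination_numberP _ _ total_defined.
  exact/domination_number_le/total_dominatingW.
rewrite /watchman_number; case: ex_minnP => n /existsP[x /existsP[p cdw]] _.
have [p0|pN0] := eqVneq (val p) [::].
  case: total_defined => S tS; suff dx : dominating e [set x].
    by have := tournament_dominating1 _ _ _ S te dx; rewrite tS.
  by case/andP: cdw => _; rewrite p0 set_seq1.
apply: leq_trans (total_domination_number_le _ _ _
  (closed_walk_total_dominating _ _ _ _ (tournament_irr te) pN0 cdw)) _.
(* The length [n] counts the entries of [p] with repetition, so it bounds the number of distinct
   ones. *)
by rewrite cardsE -[leqRHS](size_tuple p) card_size.
Qed.
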